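(* Let $p$ be a prime and let $q=p^\alpha$ with $\alpha>0$ an integer. Let $k\geq 2$ be an integer. Let $L\subseteq\{0,1,\ldots,q-1\}$ be a proper subset with $|L|=s>0$. Let $n$ be a positive integer and let $\mathcal F\subseteq 2^{[n]}$ be a family of subsets of $[n]$ such that for every $F\in\mathcal F$, $|F|\not\equiv \ell\pmod q$ for all $\ell\in L$, and such that for any $k$ distinct sets $F_1,\ldots,F_k\in\mathcal F$ there exists $\ell\in L$ with $|F_1\cap\cdots\cap F_k|\equiv \ell\pmod q$. Then $$|\mathcal F|\leq (k-1)\sum_{j=0}^{q-1}\binom{n}{j}.$$
   Context: $2^{[n]}$ denotes the family of all subsets of $[n]=\{1,\ldots,n\}$. *)

(* Defs.v *)
From mathcomp Require Export all_boot.

Set Implicit Arguments.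
Unset Strict Implicit.
Unset Printing Implicit Defensive.

(* Main.v *)
Require Import Defs.
From mathcomp Require Import all_boot all_algebra.

(** Over ['F_p] with [q = p ^ alpha], the binomials [x |-> 'C(x, m)], [m < q],
    are [q]-periodic and span all [q]-periodic functions of [x : nat], so the
    indicator of "[x] mod [q] is not in [L]" is [h x = \sum_(m < q) c m * 'C(x, m)].
    Attach to a set [A] the vector [v A] of the indicators of [S \subset A] for
    [#|S| < q]; then [h #|A :&: B|] is a linear functional [phi_B] of [v A].
    In a subfamily [G], take a largest [D] with [0 < #|D| < k] whose
    intersection [B] satisfies [h #|B| != 0].  Then [phi_B] kills [v A] for [A]
    in [G] outside [D] and not for [A] in [D], so removing the at most [k - 1]
    members of [D] from [G] lowers the dimension of the span of the [v A]. *)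

Import GRing.Theory.

(** The system is unitriangular, as ['C(x, m)] is 0 for [x < m] and 1 for [x = m], so each new
    coefficient is found without division. *)
Lemma newton_interpolation (R : comNzRingType) (h : nat -> R) (N : nat) :
  exists c : nat -> R,
    forall x, x < N -> h x = (\sum_(m < N) c m * 'C(x, m)%:R)%R.
Proof.
elim: N => [|N [c hc]]; first by exists (fun=> 0%R).
pose d := (h N - \sum_(m < N) c m * 'C(N, m)%:R)%R.
exists (fun m => if m == N then d else c m) => x.
have lower y :
    (\sum_(m < N) (if m == N :> nat then d else c m) * 'C(y, m)%:R
      = \sum_(m < N) c m * 'C(y, m)%:R)%R.
  by apply: eq_bigr => m _; rewrite (ltn_eqF (ltn_ord m)).
rewrite ltnS leq_eqVlt big_ord_recr /= eqxx lower => /orP[/eqP->|ltxN].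
  by rewrite binn mulr1 addrC subrK.
by rewrite -hc // bin_small // mulr0 addr0.
Qed.

(** Since [i * 'C(p ^ a, i)] is a multiple of [p ^ a], a binomial prime to [p] would force [p ^ a]
    to divide the smaller positive [i]. *)
Lemma prime_dvd_bin_expn (p a i : nat) :
  prime p -> 0 < i < p ^ a -> p %| 'C(p ^ a, i).
Proof.
move=> pr_p; case: i => // i /andP[_ lti].
apply/negPn/negP => /negP ndvd.
have: p ^ a %| i.+1.
  rewrite -(@Gauss_dvdl _ _ 'C(p ^ a, i.+1)).
    by rewrite -mul_bin_diag dvdn_mulr.
  by rewrite coprimeXl // prime_coprime //; apply/negP.
by move/(dvdn_leq (ltn0Sn i)); rewrite leqNgt lti.
Qed.

(** In the Vandermonde convolution, [p] divides every term except the one with index 0. *)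
Lemma bin_addl_expn_mod (p a x m : nat) :
  prime p -> m < p ^ a -> 'C(p ^ a + x, m) = 'C(x, m) %[mod p].
Proof.
move=> pr_p ltm; rewrite -binomial.Vandermonde big_ord_recl /= bin0 mul1n subn0.
rewrite -modnDmr (_ : (\sum_(i < m) _) %% p = 0) ?addn0 //.
apply/eqP; apply: dvdn_sum => i _; rewrite dvdn_mulr // prime_dvd_bin_expn //=.
exact: leq_ltn_trans (ltn_ord i) ltm.
Qed.

(** Interpolation settles one period; both sides are periodic, so it extends to all [x]. *)
Lemma periodic_binomial_expansion (p a : nat) (h : nat -> 'F_p) :
  prime p -> (forall x, h (x %% p ^ a) = h x) ->
  exists c : nat -> 'F_p,
    forall x, h x = (\sum_(m < p ^ a) c m * 'C(x, m)%:R)%R.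
Proof.
move=> pr_p hper; have [c hc] := newton_interpolation _ h (p ^ a).
exists c => x; rewrite -hper hc ?ltn_mod ?expn_gt0 ?prime_gt0 //.
apply: eq_bigr => m _; congr (_ * _)%R.
rewrite [in RHS](divn_eq x (p ^ a)).
elim: (x %/ p ^ a) => [|t IHt]; first by rewrite mul0n.
rewrite IHt mulSn -addnA; apply: val_inj.
by rewrite /= !val_Fp_nat // bin_addl_expn_mod.
Qed.

Section KWise.

Variables (K : fieldType) (n q k : nat) (c : nat -> K).

Definition small_sets : {set {set 'I_n}} := [set S : {set _} | #|S| < q].

Definition incidence (A : {set 'I_n}) : 'rV[K]_#|small_sets| :=
  (\row_i ((enum_val i : {set 'I_n}) \subset A)%:R)%R.

Definition incidence_span (G : {set {set 'I_n}}) : 'M[K]_#|small_sets| :=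
  (\sum_(A in G) <<incidence A>>)%MS.

Definition weighted_incidence (B : {set 'I_n}) : 'cV[K]_#|small_sets| :=
  (\col_i (let S : {set 'I_n} := enum_val i in c #|S| * (S \subset B)%:R))%R.

Definition binomial_comb (x : nat) : K := (\sum_(m < q) c m * 'C(x, m)%:R)%R.

Lemma card_small_sets : #|small_sets| = \sum_(0 <= j < q) 'C(n, j).
Proof.
rewrite big_mkord -sum1_card /small_sets.
(* [inord] needs a successor bound, so [q = 0] is split off; on sizes below [q] it loses nothing. *)
case: (q) => [|q']; first by rewrite big_ord0 big1 // => S; rewrite inE.
rewrite (partition_big (fun S : {set 'I_n} => inord #|S| : 'I_q'.+1) xpredT) //=.
apply: eq_bigr => j _; rewrite sum1_card -[n in RHS]card_ord -card_draws.
apply: eq_card => S; rewrite !inE unfold_in /= inE.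
apply/andP/eqP => [[ltS /eqP<-]|->]; first by rewrite inordK.
by rewrite ltn_ord inord_val.
Qed.

(** The product sums [c #|S|] over the small [S] inside [A :&: B]; grouping these by size produces
    the binomials. *)
Lemma incidence_mulmx (A B : {set 'I_n}) :
  (incidence A *m weighted_incidence B)%R = (binomial_comb #|A :&: B|)%:M%R.
Proof.
apply/matrixP => i0 j0; rewrite !ord1 !mxE /=.
under eq_bigr do rewrite !mxE mulrCA -natrM mulnb -subsetI.
rewrite -(big_enum_val (fun S : {set 'I_n} => (c #|S| * (S \subset A :&: B)%:R)%R)).
rewrite /binomial_comb /small_sets; case: (q) => [|q'].
  by rewrite big_ord0 big1 // => S; rewrite inE.
rewrite (partition_big (fun S : {set 'I_n} => inord #|S| : 'I_q'.+1) xpredT) //=.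
apply: eq_bigr => j _; rewrite -cards_draws -sum1_card natr_sum mulr_sumr.
rewrite [RHS](eq_bigl (fun S : {set 'I_n} =>
  (S \in [set S : {set 'I_n} | #|S| < q'.+1]) && (inord #|S| == j) &&
  (S \subset A :&: B))).
  rewrite [RHS]big_mkcondr; apply: eq_bigr => S; rewrite inE => /andP[ltS /eqP<-].
  by rewrite inordK //; case: ifP => _; rewrite ?mulr1 ?mulr0.
move=> S; rewrite !inE andbC; congr (_ && _).
apply/eqP/andP => [->|[ltS /eqP<-]]; first by rewrite ltn_ord inord_val.
by rewrite inordK.
Qed.

Variable F : {set {set 'I_n}}.
Hypothesis k_gt1 : 1 < k.
Hypothesis F_single : forall A, A \in F -> binomial_comb #|A| != 0%R.
Hypothesis F_kwise : forall D : {set {set 'I_n}}, D \subset F -> #|D| = k ->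
  binomial_comb #|\bigcap_(A in D) A| = 0%R.

Lemma exists_separating_subfamily (G : {set {set 'I_n}}) :
  G \subset F -> G != set0 ->
  exists D : {set {set 'I_n}}, [/\ D \subset G, 0 < #|D| < k,
    binomial_comb #|\bigcap_(A in D) A| != 0%R &
    forall A, A \in G :\: D ->
      binomial_comb #|A :&: \bigcap_(A' in D) A'| = 0%R].
Proof.
move=> sGF /set0Pn[A0 GA0].
pose P (D : {set {set 'I_n}}) := [&& D \subset G, 0 < #|D| < k &
  binomial_comb #|\bigcap_(A in D) A| != 0%R].
have P0 : P [set A0].
  by rewrite /P sub1set GA0 cards1 k_gt1 big_set1 F_single // (subsetP sGF).
case: (arg_maxnP (fun D : {set {set 'I_n}} => #|D|) P0) => D.
case/and3P => sDG /andP[D0 ltDk] hD maxD; exists D; split; rewrite ?D0 //.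
move=> A /setDP[GA DA]; apply/eqP/negPn/negP => hA.
have sAD : A |: D \subset G by rewrite subUset sub1set GA.
have cardAD : #|A |: D| = #|D|.+1 by rewrite cardsU1 DA.
rewrite -big_setU1 //= in hA.
(* Adding [A] to [D] either reaches size [k], where [F_kwise] applies, or contradicts maximality. *)
move: ltDk; rewrite leq_eqVlt => /orP[/eqP eqk|ltk].
  by rewrite F_kwise ?eqxx ?cardAD ?(subset_trans sAD) in hA.
suff /maxD : P (A |: D) by rewrite /= cardAD ltnn.
by rewrite /P sAD cardAD ltk hA.
Qed.

Lemma kwise_subfamily_rank (G : {set {set 'I_n}}) :
  G \subset F ->
  #|G| <= (k - 1) * \rank (incidence_span G).
Proof.
have [N] := ubnP #|G|; elim: N G => // N IHN G ltGN sGF.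
have [->|/(exists_separating_subfamily _ sGF)] := eqVneq G set0.
  by rewrite cards0.
case=> D [sDG /andP[D0 ltDk] hD hGD].
have /card_gt0P[A DA] := D0.
have sGDG : G :\: D \subset G := subsetDl _ _.
have cardG : #|G| = #|D| + #|G :\: D|.
  by rewrite -(cardsID D G) (setIidPr sDG).
have leD : #|D| <= k - 1 by rewrite subn1 -ltnS prednK // ltnW.
rewrite cardG; apply: (@leq_trans ((k - 1) + #|G :\: D|)); first by rewrite leq_add2r.
have /IHN/(_ (subset_trans sGDG sGF)) leGD : #|G :\: D| < N.
  by apply: leq_trans (_ : #|G| <= N) => //; rewrite cardG -addn1 addnC leq_add2r.
(* One lost dimension pays for the at most [k - 1] sets of [D]. *)
apply: (@leq_trans ((k - 1) * (\rank (incidence_span (G :\: D)%SET)).+1)).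
  by rewrite mulnS leq_add2l.
rewrite leq_mul2l; apply/orP; right; apply: rank_ltmx; rewrite /ltmx.
apply/andP; split.
  apply/sumsmx_subP => A' GDA'; apply: (sumsmx_sup A') => //.
  exact: subsetP GDA'.
(* If the span did not shrink, the functional of the intersection of [D] would also kill
   [incidence A] for the chosen [A] in [D]; but [A] contains that intersection, so the value there
   is the nonzero one in [hD]. *)
apply/negP => sub.
have kills : (incidence_span (G :\: D)%SET <=
    kermx (weighted_incidence (\bigcap_(A in D) A)))%MS.
  apply/sumsmx_subP => A' GDA'; rewrite genmxE; apply/sub_kermxP.
  by rewrite incidence_mulmx hGD // raddf0.
have : (incidence A <= kermx (weighted_incidence (\bigcap_(A in D) A)))%MS.
  apply: submx_trans kills; apply: submx_trans sub.
  by apply: (sumsmx_sup A); rewrite ?genmxE // (subsetP sDG).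
move/sub_kermxP; rewrite incidence_mulmx (setIidPr (bigcap_inf _ DA)) //.
move/matrixP/(_ 0%R 0%R); rewrite !mxE /= mulr1n => h0.
by rewrite h0 eqxx in hD.
Qed.

Lemma kwise_bound : #|F| <= (k - 1) * \sum_(0 <= j < q) 'C(n, j).
Proof.
apply: leq_trans (kwise_subfamily_rank _ (subxx F)) _.
by rewrite -card_small_sets leq_mul2l rank_leq_col orbT.
Qed.

End KWise.

Theorem theorem1p6 (p alpha q k s n : nat)
    (L : {set 'I_q}) (F : {set {set 'I_n}}) :
  prime p -> 0 < alpha -> q = p ^ alpha ->
  2 <= k ->
  L \proper [set: 'I_q] -> #|L| = s -> 0 < s ->
  0 < n ->
  (forall A : {set 'I_n}, A \in F ->
     forall l : 'I_q, l \in L -> #|A| <> l %[mod q]) ->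
  (forall f : 'I_k -> {set 'I_n},
     injective f -> (forall i, f i \in F) ->
     exists2 l : 'I_q, l \in L & #|\bigcap_(i < k) f i| = l %[mod q]) ->
  #|F| <= (k - 1) * \sum_(0 <= j < q) 'C(n, j).
Proof.
move=> pr_p _ def_q k2 _ _ _ _ F1 Fk.
pose avoids x := [forall l in L, x != l %[mod q]].
pose h x : 'F_p := ((avoids x)%:R)%R.
have hper x : h (x %% p ^ alpha) = h x.
  rewrite /h /avoids -def_q; congr (nat_of_bool _)%:R%R.
  by apply: eq_forallb => l; rewrite modn_mod.
have [c hc] := periodic_binomial_expansion _ _ _ pr_p hper; rewrite -def_q in hc.
apply: (@kwise_bound _ n q k c) => // [A FA|D sDF cardD].
  rewrite /binomial_comb -hc /h (_ : avoids _) ?oner_eq0 //.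
  by apply/forall_inP => l Ll; apply/eqP; apply: F1.
rewrite /binomial_comb -hc /h (_ : avoids _ = false) //.
(* Once [k] is replaced by [#|D|], [enum_val] is the required injective indexing of [D]. *)
subst k; have [|i|l Ll eql] := Fk (fun i => enum_val i).
- exact: enum_val_inj.
- exact: subsetP (enum_valP i).
by apply/negbTE/forall_inPn; exists l => //; rewrite big_enum_val eql eqxx.
Qed.
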